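(* Let $X$ be a topological space and let $g:X\times X\to\mathbb{R}$ be a continuous function such that for all $x,y,z\in X$: $g(x,y)=0$ if and only if $x=y$; $|g(x,y)|=|g(y,x)|$; and $|g(x,z)|\le |g(x,y)|+|g(y,z)|$. Suppose $X$ is $g$-complete. Let $(A,B)$ be a pair of non-empty subsets of $X$ such that $A_g$ is non-empty and $g$-closed. Let $\beta\in(0,1)$ and $N\ge 0$, and let $T:A\to B$ be a topologically proximal weak contraction mapping with respect to $g$ with constants $\beta$ and $N$, such that $T(A_g)\subseteq B_g$. Then: (1) there exists a best proximity point $p^*\in A_g$ of $T$, and any sequence $\{p_n\}_{n\ge 0}$ in $A_g$ defined by $p_0\in A_g$ and $|g(p_{n+1},T(p_n))|=D_g(A,B)$ for all $n\ge 0$ is $g$-convergent to a best proximity point of $T$ in $A_g$; (2) if moreover $1-\beta-N>0$, then the best proximity point $p^*$ of $T$ is unique.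
   Context: Let $X$ be a topological space and $g:X\times X\to\mathbb{R}$ a continuous function (with the product topology on $X\times X$). A sequence $\{x_n\}$ in $X$ is $g$-convergent to $x\in X$ if $|g(x_n,x)|\to 0$ as $n\to\infty$. It is $g$-Cauchy if $|g(x_n,x_m)|\to 0$ as $n,m\to\infty$. $X$ is $g$-complete if every $g$-Cauchy sequence in $X$ is $g$-convergent to some point of $X$. A non-empty subset $C\subseteq X$ is $g$-closed if whenever a sequence in $C$ is $g$-convergent to a point $x\in X$, then $x\in C$. For non-empty $A,B\subseteq X$ put $D_g(A,B)=\inf\{|g(x,y)|: x\in A,\ y\in B\}$, $A_g=\{x\in A: |g(x,y)|=D_g(A,B)\text{ for some }y\in B\}$ and $B_g=\{y\in B: |g(x,y)|=D_g(A,B)\text{ for some }x\in A\}$. A mapping $f:A\to B$ is a topologically proximal weak contraction with respect to $g$ with constants $\beta\in(0,1)$ and $N\ge 0$ if for all $x_1,x_2,u_1,u_2\in A$, the equalities $|g(u_1,f(x_1))|=D_g(A,B)$ and $|g(u_2,f(x_2))|=D_g(A,B)$ imply $|g(u_1,u_2)|\le\beta|g(x_1,x_2)|+N|g(x_2,u_1)|$. A best proximity point of $f:A\to B$ is a point $p\in A$ with $|g(p,f(p))|=D_g(A,B)$. *)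

(* Defs.v *)
From HB Require Import structures.
From mathcomp Require Import all_boot all_order all_algebra.
From mathcomp Require Import all_classical all_reals all_analysis.

Set Implicit Arguments.
Unset Strict Implicit.
Unset Printing Implicit Defensive.

Import Order.TTheory GRing.Theory Num.Theory numFieldNormedType.Exports.
Local Open Scope classical_set_scope.
Local Open Scope ring_scope.

Definition g_convergent (R : realType) (X : topologicalType) (g : X * X -> R)
    (x_ : nat -> X) (x : X) : Prop :=
  `|g (x_ n, x)| @[n --> \oo] --> (0 : R).

(* The two indices go to infinity independently: the limit is taken along the
   product filter on nat * nat. *)
Definition g_cauchy (R : realType) (X : topologicalType) (g : X * X -> R)
    (x_ : nat -> X) : Prop :=
  `|g (x_ nm.1, x_ nm.2)| @[nm --> (\oo, \oo)] --> (0 : R).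

Definition g_complete (R : realType) (X : topologicalType) (g : X * X -> R) :
    Prop :=
  forall x_ : nat -> X, g_cauchy g x_ -> exists x : X, g_convergent g x_ x.

Definition g_closed (R : realType) (X : topologicalType) (g : X * X -> R)
    (C : set X) : Prop :=
  C !=set0 /\
  forall (x_ : nat -> X) (x : X),
    (forall n, C (x_ n)) -> g_convergent g x_ x -> C x.

Definition g_dist (R : realType) (X : topologicalType) (g : X * X -> R)
    (A B : set X) : R :=
  inf [set `|g (x, y)| | x in A & y in B].

(* A_g; it depends on B as well. *)
Definition g_left (R : realType) (X : topologicalType) (g : X * X -> R)
    (A B : set X) : set X :=
  [set x | A x /\ exists2 y, B y & `|g (x, y)| = g_dist g A B].

(* B_g; it depends on A as well. *)
Definition g_right (R : realType) (X : topologicalType) (g : X * X -> R)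
    (A B : set X) : set X :=
  [set y | B y /\ exists2 x, A x & `|g (x, y)| = g_dist g A B].

(* A mapping A -> B is represented by a function f : X -> X sending A into B;
   its values outside A are never used. *)
Definition proximal_weak_contraction (R : realType) (X : topologicalType)
    (g : X * X -> R) (A B : set X) (beta N : R) (f : {fun A >-> B}) : Prop :=
  forall x1 x2 u1 u2 : X, A x1 -> A x2 -> A u1 -> A u2 ->
    `|g (u1, f x1)| = g_dist g A B ->
    `|g (u2, f x2)| = g_dist g A B ->
    `|g (u1, u2)| <= beta * `|g (x1, x2)| + N * `|g (x2, u1)|.

Definition best_proximity_point (R : realType) (X : topologicalType)
    (g : X * X -> R) (A B : set X) (f : {fun A >-> B}) (p : X) : Prop :=
  A p /\ `|g (p, f p)| = g_dist g A B.

(* Main.v *)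
Require Import Defs.
From HB Require Import structures.
From mathcomp Require Import all_boot all_order all_algebra.
From mathcomp Require Import all_classical all_reals all_analysis.
From mathcomp Require Import ring lra.

(** The function [|g|] is a metric, and a weak contraction drives every
    proximal Picard sequence [p n.+1] (a point realizing the distance from
    [T (p n)]) to a limit, as in Banach's fixed point theorem.

    The term [N * |g (x2, u1)|] of the weak contraction is harmless along such
    a sequence: for [x1 = p n] and [x2 = u1 = p n.+1] it vanishes, so consecutive
    distances shrink by the factor [beta] ([proximal_picard_steps]); the
    sequence is then g-Cauchy ([geometric_steps_g_cauchy]) and, by completeness
    and closedness of [g_left g A B], g-converges to some [p] in that set.

    For this limit, [T p] lies in [g_right g A B], so some [u] in [A] realizes
    the distance from [T p].  Comparing [u] with [p n.+1] through the weak
    contraction bounds [|g (p n.+1, u)|] by a combination of the distances from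
    [p n] and [p n.+1] to [p], which tend to [0]; by uniqueness of limits
    [u = p], so [p] is a best proximity point ([proximal_picard_limit]).

    Existence follows because a Picard sequence starts at every point of
    [g_left g A B] ([proximal_picard_exists]).  Two best proximity points at
    distance [d] satisfy [d <= (beta + N) * d], whence uniqueness when
    [beta + N < 1]. *)

Set Implicit Arguments.
Unset Strict Implicit.
Unset Printing Implicit Defensive.

Import Order.TTheory GRing.Theory Num.Theory numFieldNormedType.Exports.
Local Open Scope classical_set_scope.
Local Open Scope ring_scope.

Section GMetric.
Variables (R : realType) (X : topologicalType) (g : X * X -> R).
Hypothesis g_eq0 : forall x y : X, g (x, y) = 0 <-> x = y.
Hypothesis g_sym : forall x y : X, `|g (x, y)| = `|g (y, x)|.
Hypothesis g_triangle : forall x y z : X,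
  `|g (x, z)| <= `|g (x, y)| + `|g (y, z)|.

Lemma normg_xx (x : X) : `|g (x, x)| = 0.
Proof. by have /g_eq0 -> := erefl x; rewrite normr0. Qed.

Lemma normg_eq0 (x y : X) : `|g (x, y)| <= 0 -> x = y.
Proof. by rewrite normr_le0 => /eqP /g_eq0. Qed.

Lemma g_convergent_unique (x_ : nat -> X) (x y : X) :
  g_convergent g x_ x -> g_convergent g x_ y -> x = y.
Proof.
move=> x_x x_y; apply: normg_eq0.
have sum0 : `|g (x_ n, x)| + `|g (x_ n, y)| @[n --> \oo] --> (0 : R).
  by rewrite -[0 in X in _ --> X]addr0; apply: cvgD.
apply: (cvgr_to_ge sum0).
by near=> n; rewrite (g_sym (x_ n) x) g_triangle.
Unshelve. all: by end_near. Qed.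

(** Since [beta ^+ n = (beta ^+ n - beta ^+ n.+1) / (1 - beta)], the bounds on
    the steps telescope.  The resulting bound is stated symmetrically in the two
    indices, so that no ordering of them is needed when they go to infinity
    independently. *)
Lemma geometric_steps_g_cauchy (beta c : R) (x_ : nat -> X) :
  0 < beta -> beta < 1 ->
  (forall n, `|g (x_ n, x_ n.+1)| <= c * beta ^+ n) -> g_cauchy g x_.
Proof.
move=> beta_gt0 beta_lt1 steps.
have c_ge0 : 0 <= c by have := steps 0%N; rewrite expr0 mulr1; apply: le_trans.
set C := c / (1 - beta).
have C_ge0 : 0 <= C by rewrite divr_ge0 // subr_ge0 ltW.
have telescoped n k :
    `|g (x_ n, x_ (n + k)%N)| <= C * beta ^+ n - C * beta ^+ (n + k).
  elim: k => [|k IHk]; first by rewrite addn0 normg_xx subrr.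
  rewrite addnS; apply: (le_trans (g_triangle _ (x_ (n + k)%N) _)).
  have -> : C * beta ^+ n - C * beta ^+ (n + k).+1 =
            (C * beta ^+ n - C * beta ^+ (n + k)) + c * beta ^+ (n + k).
    by rewrite exprS /C; field; rewrite subr_eq0 gt_eqF.
  exact: lerD.
have bound n m : `|g (x_ n, x_ m)| <= C * beta ^+ n + C * beta ^+ m.
  wlog le_nm : n m / (n <= m)%N.
    by move=> H; case/orP: (leq_total n m) => /H //; rewrite g_sym addrC.
  rewrite -(subnKC le_nm); apply: (le_trans (telescoped _ _)).
  by rewrite lerD2l ge0_cp // mulr_ge0 // exprn_ge0 // ltW.
have geom0 : C * beta ^+ n @[n --> \oo] --> (0 : R).
  rewrite -(mulr0 C); apply: cvgMl_tmp; apply: cvg_expr.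
  by rewrite ger0_norm // ltW.
have pair0 : C * beta ^+ nm.1 + C * beta ^+ nm.2 @[nm --> (\oo, \oo)]
    --> (0 : R).
  rewrite -[0 in X in _ --> X]addr0; apply: cvgD.
  - exact: cvg_comp cvg_fst geom0.
  - exact: cvg_comp cvg_snd geom0.
apply: (squeeze_cvgr _ (cvg_cst 0) pair0).
by near=> nm; rewrite normr_ge0 bound.
Unshelve. all: by end_near. Qed.

Section ProximalPicard.
Variables (A B : set X) (T : {fun A >-> B}).
Hypothesis T_AgBg : T @` g_left g A B `<=` g_right g A B.

Lemma proximal_step (x : X) : g_left g A B x ->
  exists2 u, g_left g A B u & `|g (u, T x)| = g_dist g A B.
Proof.
move=> Agx; have [BTx [u Au uTx]] : g_right g A B (T x).
  by apply: T_AgBg; exists x.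
by exists u => //; split=> //; exists (T x).
Qed.

Lemma proximal_picard_exists : g_left g A B !=set0 ->
  exists p_ : nat -> X, (forall n, g_left g A B (p_ n)) /\
    (forall n, `|g (p_ n.+1, T (p_ n))| = g_dist g A B).
Proof.
move=> [x0 Agx0].
have step (x : X) : exists u, g_left g A B x ->
    g_left g A B u /\ `|g (u, T x)| = g_dist g A B.
  have [/proximal_step[u Agu uTx]|nAgx] := pselect (g_left g A B x).
    by exists u.
  by exists x.
have [f fP] := choice step.
have Ag_iter n : g_left g A B (iter n f x0).
  by elim: n => //= n /fP[].
by exists (fun n => iter n f x0); split=> // n; have [] := fP _ (Ag_iter n).
Qed.

Variables beta N : R.
Hypothesis T_contraction : proximal_weak_contraction g beta N T.

Section Sequence.
Variable p_ : nat -> X.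
Hypothesis Ag_p : forall n, g_left g A B (p_ n).
Hypothesis p_step : forall n, `|g (p_ n.+1, T (p_ n))| = g_dist g A B.

(** With [x2 = u1 = p_ n.+1] the term with factor [N] is the distance from a
    point to itself. *)
Lemma proximal_picard_steps n : 0 < beta ->
  `|g (p_ n, p_ n.+1)| <= `|g (p_ 0%N, p_ 1%N)| * beta ^+ n.
Proof.
move=> beta_gt0; elim: n => [|n IHn]; first by rewrite expr0 mulr1.
have A_p k : A (p_ k) by have [] := Ag_p k.
have := T_contraction (A_p n) (A_p n.+1) (A_p n.+1) (A_p n.+2)
  (p_step n) (p_step n.+1).
rewrite normg_xx mulr0 addr0 => /le_trans; apply.
by rewrite exprS mulrCA ler_pM2l.
Qed.

(** The distance from [T p] is realized by some [u], and the weak contraction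
    makes the sequence converge to [u] as well as to [p], so that [u = p]. *)
Lemma proximal_picard_limit (p : X) :
  g_left g A B p -> g_convergent g p_ p -> best_proximity_point g T p.
Proof.
move=> Agp p_p; have [u [Au _] uTp] := proximal_step Agp.
have [Ap _] := Agp.
have p_p1 : `|g (p_ n.+1, p)| @[n --> \oo] --> (0 : R).
  by have := p_p; rewrite /g_convergent -cvg_shiftS.
suff p_u : g_convergent g p_ u.
  by split=> //; rewrite {1}(g_convergent_unique p_p p_u).
rewrite /g_convergent -cvg_shiftS /=.
have bound0 : beta * `|g (p_ n, p)| + N * `|g (p_ n.+1, p)| @[n --> \oo]
    --> (0 : R).
  have -> : 0 = beta * 0 + N * 0 :> R by rewrite !mulr0 addr0.
  by apply: cvgD; exact: cvgMl_tmp.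
apply: (squeeze_cvgr _ (cvg_cst 0) bound0).
near=> n; rewrite normr_ge0 /= (g_sym (p_ n.+1) p).
have [[A_n _] [A_n1 _]] := (Ag_p n, Ag_p n.+1).
exact: T_contraction.
Unshelve. all: by end_near. Qed.

End Sequence.

Lemma best_proximity_point_unique (p q : X) : 0 < 1 - beta - N ->
  best_proximity_point g T p -> best_proximity_point g T q -> p = q.
Proof.
move=> lt_betaN [Ap pTp] [Aq qTq]; apply: normg_eq0.
have := T_contraction Ap Aq Ap Aq pTp qTq.
rewrite (g_sym q p) -(pmulr_rle0 _ lt_betaN).
by lra.
Qed.

End ProximalPicard.

End GMetric.

Theorem theorem2p24 (R : realType) (X : topologicalType) (g : X * X -> R)
    (g_cont : continuous g)
    (g_eq0 : forall x y : X, g (x, y) = 0 <-> x = y)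
    (g_sym : forall x y : X, `|g (x, y)| = `|g (y, x)|)
    (g_triangle : forall x y z : X,
      `|g (x, z)| <= `|g (x, y)| + `|g (y, z)|)
    (X_complete : g_complete g)
    (A B : set X) (A_neq0 : A !=set0) (B_neq0 : B !=set0)
    (Ag_neq0 : g_left g A B !=set0) (Ag_closed : g_closed g (g_left g A B))
    (beta N : R) (beta_gt0 : 0 < beta) (beta_lt1 : beta < 1) (N_ge0 : 0 <= N)
    (T : {fun A >-> B})
    (T_contraction : proximal_weak_contraction g beta N T)
    (T_AgBg : T @` g_left g A B `<=` g_right g A B) :
  [/\ exists2 p : X, g_left g A B p & best_proximity_point g T p,
      forall p_ : nat -> X,
        (forall n, g_left g A B (p_ n)) ->
        (forall n, `|g (p_ n.+1, T (p_ n))| = g_dist g A B) ->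
        exists p : X, [/\ g_left g A B p, best_proximity_point g T p &
                          g_convergent g p_ p]
    & 0 < 1 - beta - N -> exists! p : X, best_proximity_point g T p].
Proof.
have picard_cvg (p_ : nat -> X) :
    (forall n, g_left g A B (p_ n)) ->
    (forall n, `|g (p_ n.+1, T (p_ n))| = g_dist g A B) ->
    exists p : X, [/\ g_left g A B p, best_proximity_point g T p &
                      g_convergent g p_ p].
  move=> Ag_p p_step.
  have [|p p_p] := X_complete p_.
    apply: (geometric_steps_g_cauchy g_eq0 g_sym g_triangle beta_gt0 beta_lt1).
    by move=> n; apply: (proximal_picard_steps g_eq0 T_contraction).
  have Agp : g_left g A B p by case: Ag_closed => _; apply; eauto.
  exists p; split=> //.
  exact: (proximal_picard_limit g_eq0 g_sym g_triangle T_AgBg T_contraction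
    Ag_p p_step).
have [p_ [Ag_p p_step]] := proximal_picard_exists T_AgBg Ag_neq0.
have [p [Agp best_p _]] := picard_cvg p_ Ag_p p_step.
split=> [||lt_betaN] //; first by exists p.
exists p; split=> // q.
exact: (best_proximity_point_unique g_eq0 g_sym T_contraction).
Qed.
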